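(* For every power of two $q\ge 4$ there is an even orientable no-fold product structure of type $(2q,2q)$ with $$\operatorname{girth}(L_1)=6,\qquad L_A\cong L_B\cong K_{q,q},$$ so that $\operatorname{girth}(L_1)/2=3$ and $\operatorname{girth}(L_{AB})=4$. Consequently the pair $(\operatorname{girth}(L_{AB}),\operatorname{girth}(L_1)/2)=(4,3)$ is realized, and the number $p^\ast$, defined as the least integer $p\ge 3$ such that there is no orientable no-fold product structure $\Pi$ (even or odd, with both $|A|,|B|\ge2$) with $\operatorname{girth}(L_{AB}(\Pi))\ge p$ and $\operatorname{girth}(L_1(\Pi))\ge 6$, satisfies $p^\ast\in\{5,6\}$.
   Context: A product structure of type $(m,n)$ is a triple $\Pi=(A,B,P)$ with $A,B$ finite (disjoint) sets, $|A|=m$, $|B|=n$, and $P$ a partition of $A\times B$ into cells such that if two distinct positions $(a,b),(a',b')$ lie in the same cell then $a\ne a'$ and $b\ne b'$. It is even if every cell has size $2$, and odd if exactly one cell has size $1$ and all others have size $2$. Horizontal graphs: $L_A$ is the simple graph on $A$ in which $\{a,a'\}$ is an edge iff there are $b,b'\in B$ with $\{(a,b),(a',b')\}\in P$; $L_B$ is the simple graph on $B$ in which $\{b,b'\}$ is an edge iff there are $a,a'\in A$ with $\{(a,b),(a',b')\}\in P$. $L_{AB}=L_A\sqcup L_B$. Colors are the classes of the equivalence relation on $E(L_A)\sqcup E(L_B)$ generated by declaring, for each 2-cell $\{(a,b),(a',b')\}$, the edge $\{a,a'\}$ equivalent to the edge $\{b,b'\}$. A coherent orientation $O$ is a choice of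 one direction for each edge of $L_A$ and $L_B$ such that for every 2-cell $\{(a,b),(a',b')\}$ either $a\to a'$ and $b\to b'$, or $a'\to a$ and $b'\to b$. $(\Pi,O)$ is no-fold if no vertex has two distinct outgoing edges of the same color or two distinct incoming edges of the same color. An orientable no-fold product structure is one admitting a coherent orientation $O$ with $(\Pi,O)$ no-fold, considered together with one such fixed $O$. Each color $c$ has two signed colors $(c,\mathrm{out}),(c,\mathrm{in})$. The middle link $L_1$ is the simple bipartite graph with parts $A\sqcup B$ and the set of signed colors, where $v$ is adjacent to $(c,\mathrm{out})$ iff $v$ is the tail of some edge of color $c$, and to $(c,\mathrm{in})$ iff $v$ is the head of some edge of color $c$. Girth is the length of a shortest cycle, $\infty$ for acyclic graphs; the girth of a disconnected graph is the minimum over its components. $K_{q,q}$ is the complete bipartite graph. *)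

(* Defs.v *)
(* Plain MathComp development. *)
From mathcomp Require Import all_boot.

Set Implicit Arguments.
Unset Strict Implicit.
Unset Printing Implicit Defensive.

Record sgraph := SGraph {
  vertex :> finType;
  adj : rel vertex;
  adj_sym : symmetric adj;
  adj_irr : irreflexive adj }.

Definition has_cycle (G : sgraph) (k : nat) : bool :=
  (2 < k) && [exists c : k.-tuple G, ucycleb (@adj G) c].

(* [None] stands for infinity.  Cycles have no repeated vertex, so their length
   is at most #|G| and the search below is exhaustive. *)
Definition girth (G : sgraph) : option nat :=
  ohead [seq k <- iota 0 #|G|.+1 | has_cycle G k].

Definition girth_ge (G : sgraph) (p : nat) : Prop :=
  if girth G is Some g then p <= g else True.

(* Truncated division is exact on graphs of even girth, in particular on the
   bipartite graphs [L1] below. *)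
Definition half_girth (G : sgraph) : option nat := omap half (girth G).

Definition sg_iso (G H : sgraph) : Prop :=
  exists2 f : G -> H, bijective f & {mono f : x y / adj x y}.

Definition sum_adj (G H : sgraph) : rel (G + H)%type := fun x y =>
  match x, y with
  | inl a, inl a' => adj a a'
  | inr b, inr b' => adj b b'
  | _, _ => false
  end.

Lemma sum_adj_sym (G H : sgraph) : symmetric (@sum_adj G H).
Proof. by move=> [a|b] [a'|b'] //=; rewrite adj_sym. Qed.

Lemma sum_adj_irr (G H : sgraph) : irreflexive (@sum_adj G H).
Proof. by move=> [a|b] /=; rewrite adj_irr. Qed.

Definition disjoint_union (G H : sgraph) : sgraph :=
  SGraph (@sum_adj_sym G H) (@sum_adj_irr G H).

Definition bip_adj (T S : finType) (inc : T -> S -> bool) : rel (T + S)%type :=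
  fun x y => match x, y with
  | inl t, inr s | inr s, inl t => inc t s
  | _, _ => false
  end.

Lemma bip_adj_sym (T S : finType) (inc : T -> S -> bool) :
  symmetric (bip_adj inc).
Proof. by move=> [t|s] [t'|s']. Qed.

Lemma bip_adj_irr (T S : finType) (inc : T -> S -> bool) :
  irreflexive (bip_adj inc).
Proof. by move=> [t|s]. Qed.

Definition bipartite_graph (T S : finType) (inc : T -> S -> bool) : sgraph :=
  SGraph (bip_adj_sym inc) (bip_adj_irr inc).

Definition complete_bipartite (m n : nat) : sgraph :=
  bipartite_graph (fun (_ : 'I_m) (_ : 'I_n) => true).

Definition edges (G : sgraph) : {set {set G}} :=
  [set [set p.1; p.2] | p : G * G & adj p.1 p.2].

(* [d x y] means x -> y. *)
Definition is_orientation (G : sgraph) (d : rel G) : Prop :=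
  (forall x y, d x y -> adj x y) /\ (forall x y, adj x y -> d x y = ~~ d y x).

Record product_structure := ProductStructure {
  psA : finType;
  psB : finType;
  cells : {set {set psA * psB}};
  cells_partition : partition cells [set: psA * psB];
  cells_injective : forall (C : {set psA * psB}) (x y : psA * psB),
    C \in cells -> x \in C -> y \in C -> x <> y ->
    x.1 <> y.1 /\ x.2 <> y.2 }.

Definition of_type (Pi : product_structure) (m n : nat) : Prop :=
  #|psA Pi| = m /\ #|psB Pi| = n.

Definition even_ps (Pi : product_structure) : Prop :=
  forall C, C \in cells Pi -> #|C| = 2.

Definition odd_ps (Pi : product_structure) : Prop :=
  exists C0, [/\ C0 \in cells Pi, #|C0| = 1 &
    forall C, C \in cells Pi -> C <> C0 -> #|C| = 2].

Definition two_cell (Pi : product_structure) (x y : psA Pi * psB Pi) : bool :=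
  (x != y) && ([set x; y] \in cells Pi).

(* The condition [a != a'] excludes the loop that a 1-cell {(a,b)} would
   otherwise create through [set (a,b); (a,b)]. *)
Definition LA_adj (Pi : product_structure) : rel (psA Pi) := fun a a' =>
  (a != a') && [exists b, exists b', [set (a, b); (a', b')] \in cells Pi].

Definition LB_adj (Pi : product_structure) : rel (psB Pi) := fun b b' =>
  (b != b') && [exists a, exists a', [set (a, b); (a', b')] \in cells Pi].

Lemma LA_adj_sym (Pi : product_structure) : symmetric (@LA_adj Pi).
Proof.
move=> a a'; rewrite /LA_adj eq_sym; congr (_ && _).
by apply/existsP/existsP => -[b /existsP[b' h]]; exists b'; apply/existsP;
   exists b; rewrite setUC.
Qed.

Lemma LA_adj_irr (Pi : product_structure) : irreflexive (@LA_adj Pi).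
Proof. by move=> a; rewrite /LA_adj eqxx. Qed.

Lemma LB_adj_sym (Pi : product_structure) : symmetric (@LB_adj Pi).
Proof.
move=> b b'; rewrite /LB_adj eq_sym; congr (_ && _).
by apply/existsP/existsP => -[a /existsP[a' h]]; exists a'; apply/existsP;
   exists a; rewrite setUC.
Qed.

Lemma LB_adj_irr (Pi : product_structure) : irreflexive (@LB_adj Pi).
Proof. by move=> b; rewrite /LB_adj eqxx. Qed.

Definition LA (Pi : product_structure) : sgraph :=
  SGraph (@LA_adj_sym Pi) (@LA_adj_irr Pi).

Definition LB (Pi : product_structure) : sgraph :=
  SGraph (@LB_adj_sym Pi) (@LB_adj_irr Pi).

Definition LAB (Pi : product_structure) : sgraph :=
  disjoint_union (LA Pi) (LB Pi).

Definition coherent (Pi : product_structure) (O : rel (LAB Pi)) : Prop :=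
  is_orientation O /\
  forall (a a' : psA Pi) (b b' : psB Pi), two_cell (a, b) (a', b') ->
    (O (inl a) (inl a') /\ O (inr b) (inr b')) \/
    (O (inl a') (inl a) /\ O (inr b') (inr b)).

Definition color_step (Pi : product_structure) : rel {set LAB Pi} :=
  fun e f =>
  [exists x : psA Pi * psB Pi, exists y : psA Pi * psB Pi,
    [&& two_cell x y, e == [set inl x.1; inl y.1]
      & f == [set inr x.2; inr y.2]]].

(* [connect] is reflexive and transitive; symmetrizing the step makes it the
   generated equivalence relation. *)
Definition same_color (Pi : product_structure) : rel {set LAB Pi} :=
  connect (fun e f => color_step e f || color_step f e).

Definition colors (Pi : product_structure) : {set {set {set LAB Pi}}} :=
  equivalence_partition (@same_color Pi) (edges (LAB Pi)).

Definition color (Pi : product_structure) : finType :=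
  {c : {set {set LAB Pi}} | c \in colors Pi}.

Definition out_edge (Pi : product_structure) (O : rel (LAB Pi))
    (c : color Pi) (v w : LAB Pi) : bool :=
  O v w && ([set v; w] \in val c).

Definition no_fold (Pi : product_structure) (O : rel (LAB Pi)) : Prop :=
  forall (c : color Pi) (v w w' : LAB Pi),
    (out_edge O c v w -> out_edge O c v w' -> w = w') /\
    (out_edge O c w v -> out_edge O c w' v -> w = w').

(* The pair (Pi, O) is an orientable no-fold product structure together with
   its fixed orientation. *)
Definition oriented_no_fold (Pi : product_structure) (O : rel (LAB Pi)) :=
  coherent O /\ no_fold O.

(* Signed colors: (c, true) is (c, out) and (c, false) is (c, in). *)
Definition signed_inc (Pi : product_structure) (O : rel (LAB Pi))
    (v : LAB Pi) (s : color Pi * bool) : bool :=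
  if s.2 then [exists w, out_edge O s.1 v w]
  else [exists w, out_edge O s.1 w v].

Definition L1 (Pi : product_structure) (O : rel (LAB Pi)) : sgraph :=
  bipartite_graph (signed_inc O).

Definition even_or_odd (Pi : product_structure) : Prop :=
  even_ps Pi \/ odd_ps Pi.

Definition realized (g h : nat) : Prop :=
  exists (Pi : product_structure) (O : rel (LAB Pi)),
    [/\ even_or_odd Pi, 2 <= #|psA Pi| /\ 2 <= #|psB Pi|, oriented_no_fold O,
        girth (LAB Pi) = Some g & half_girth (L1 O) = Some h].

Definition obstructed (p : nat) : Prop :=
  ~ exists (Pi : product_structure) (O : rel (LAB Pi)),
    [/\ even_or_odd Pi, 2 <= #|psA Pi| /\ 2 <= #|psB Pi|, oriented_no_fold O,
        girth_ge (LAB Pi) p & girth_ge (L1 O) 6].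

Definition is_pstar (p : nat) : Prop :=
  [/\ 3 <= p, obstructed p & forall p', 3 <= p' -> obstructed p' -> p <= p'].

(* Main.v *)
(* Existence.  Let F be the field with q = 2^k elements and lam in F \ {0, 1}.
   The words (x, y, x + y, x + lam y) form a code in which any two coordinates
   determine the word.  Take two copies of F for A (coordinates 1, 2) and two
   for B (coordinates 3, 4), and let a vertex lie on the words having its value
   at its coordinate: any two vertices at different coordinates lie on exactly
   one common word.  The signed colors are the q^2 words, and the fixed-point
   free involution s |-> s + (1, 0, 1, 1) exchanges the two signs of a color; an
   edge joins a vertex on s to the vertex on the translate of s at the other
   coordinate of the same part.

   Obstruction at girth 6.  Since L1 has no 4-cycle, a and b (outside the
   1-cell) share exactly one signed color, so |A| is the sum of the weights
   |A_s| of the signed colors s at b, and |A_s| is at most the degree of any b'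
   not in s.  Bounding |A| in this way through two vertices b, b2 of smallest
   degree in L_B, and |B| from below by the Moore bound around a well-chosen
   edge of L_B, gives |A| < |B|.  By symmetry |B| < |A|. *)
Require Import Defs.
From mathcomp Require Import all_boot all_algebra all_field zify.
From Stdlib Require Import Classical.

Set Implicit Arguments.
Unset Strict Implicit.
Unset Printing Implicit Defensive.

(** * Signed colors and the Moore bound *)

Lemma sum_bool_le1 (J : finType) (P : pred J) :
  (forall i j, P i -> P j -> i = j) -> \sum_i P i <= 1.
Proof.
move=> P1; case: (pickP P) => [i Pi|P0]; last by rewrite big1 // => i _; rewrite P0.
rewrite (bigD1 i) //= Pi big1 // => j ji.
by case Pj: (P j) => //; rewrite (P1 _ _ Pj Pi) eqxx in ji.
Qed.

Lemma sum_inj_le (J K : finType) (P : pred J) (Q : pred K) (h : J -> K) :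
  (forall i, P i -> Q (h i)) ->
  (forall i j, P i -> P j -> h i = h j -> i = j) ->
  \sum_i P i <= \sum_j Q j.
Proof.
move=> PQ h_inj.
have sum_card (L : finType) (R : pred L) : \sum_i R i = #|R|.
  by rewrite -sum1_card [RHS]big_mkcond.
rewrite !sum_card.
have h_inj' : {in P &, injective h} by move=> i j Pi Pj; apply: h_inj.
rewrite -(card_in_image h_inj'); apply: subset_leq_card.
by apply/subsetP=> _ /imageP[i Pi ->]; apply: PQ.
Qed.

Section GraphSide.

Variables (T S : finType) (e : rel T) (I : T -> S -> bool) (bar : S -> S).
Variable mate : S -> T -> T.

Definition degree (x : T) := \sum_y e x y.

(* [mate s x] is the other end of the edge of signed color [s] at [x]; [bar]
   exchanges the two signs of a color. *)
Record colored_graph : Prop := ColoredGraph {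
  cg_sym : symmetric e;
  cg_irr : irreflexive e;
  cg_tri : forall x y z, e x y -> e y z -> e z x -> False;
  cg_quad : forall x y u v, x != y -> e x u -> e u y -> e x v -> e v y -> u = v;
  cg_pent : forall x y z u v,
    e x y -> e y z -> e z u -> e u v -> e v x -> False;
  cg_linear : forall x y s t,
    x != y -> I x s -> I y s -> I x t -> I y t -> s = t;
  cg_adj : forall x s, I x s -> e x (mate s x);
  cg_bar : forall x s, I x s -> I (mate s x) (bar s);
  cg_injl : forall x y s, I x s -> I y s -> mate s x = mate s y -> x = y;
  cg_injr : forall x s t, I x s -> I x t -> mate s x = mate t x -> s = t }.

Hypothesis G : colored_graph.

Lemma color_le_degree x : \sum_s I x s <= degree x.
Proof.
apply: (@sum_inj_le _ _ (I x) (e x) (mate^~ x)) => [s xs|s t xs xt].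
  exact: (cg_adj G xs).
exact: (cg_injr G xs xt).
Qed.

Lemma card_bar s : \sum_x I x s <= \sum_x I x (bar s).
Proof.
apply: (@sum_inj_le _ _ (I^~ s) (I^~ (bar s)) (mate s)) => [x xs|x y xs ys].
  exact: (cg_bar G xs).
exact: (cg_injl G xs ys).
Qed.

Definition reach2 x y := [exists u, e x u && e u y].

(** Without 4-cycles, a vertex [y] other than [x] is reached through at most one neighbor [u] of
    [x], so the further neighbors of the various [u] never overlap. The 1 counts [x] itself, reached
    through [z]. *)
Lemma card_reach2 x z : e x z ->
  1 + \sum_u e x u * (degree u).-1 <= \sum_y reach2 x y.
Proof.
move=> xz; rewrite [leqRHS](bigD1 x) //=.
apply: leq_add; first by
  rewrite lt0b; apply/existsP; exists z; rewrite xz (cg_sym G).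
have -> : \sum_u e x u * (degree u).-1 =
    \sum_u \sum_(y | y != x) e x u * e u y.
  apply: eq_bigr => u _; rewrite -big_distrr /=.
  case xu: (e x u); rewrite ?mul0n // !mul1n /degree (bigD1 x) //=.
  by rewrite (cg_sym G) xu.
rewrite exchange_big; apply: leq_sum => y yx.
have le1 : \sum_u e x u * e u y <= 1.
  under eq_bigr => u _ do rewrite mulnb.
  apply: sum_bool_le1 => u v /andP[xu uy] /andP[xv vy].
  by apply: (cg_quad G _ xu uy xv vy); rewrite eq_sym.
case E: (reach2 x y) => //=; rewrite leqn0 big1 // => u _.
rewrite mulnb; case F: (_ && _) => //; suff: reach2 x y by rewrite E.
by apply/existsP; exists u.
Qed.

(* The vertices at distance 0 or 2 from [x] and those at distance 0 or 2 from
   its neighbor [z] are disjoint. *)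
Lemma moore_edge x z : e x z ->
  2 + \sum_u e x u * (degree u).-1 + \sum_u e z u * (degree u).-1 <= #|T|.
Proof.
move=> xz; have zx : e z x by rewrite (cg_sym G).
apply: (@leq_trans (\sum_y (reach2 x y + reach2 z y))).
  rewrite big_split /=; move: (card_reach2 xz) (card_reach2 zx); lia.
rewrite -sum1_card; apply: leq_sum => y _.
case: (boolP (reach2 x y)) => [/existsP[u /andP[xu uy]]|_]; last exact: leq_b1.
case: (boolP (reach2 z y)) => [/existsP[v /andP[zv vy]]|//].
(* A common [y] would close the walk [x], [u], [y], [v], [z] of length 5. *)
have yv : e y v by rewrite (cg_sym G).
have vz : e v z by rewrite (cg_sym G).
by case: (cg_pent G xu uy yv vz zx).
Qed.

(** The neighbors of [v] other than [w] are counted at the bound [k]; only [b] may fall short of it,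
    and the last summand makes up for the shortfall. *)
Lemma sum_neighbors b k v w : (forall u, u != b -> k <= degree u) -> e v w ->
  (degree w).-1 + (degree v).-1 * k.-1 <=
  \sum_u e v u * (degree u).-1 + (e v b && (b != w)) * (k - degree b).
Proof.
move=> kmin vw.
have -> : (degree v).-1 = \sum_(u | u != w) e v u.
  by rewrite /degree (bigD1 w) //= vw.
rewrite [X in _ <= X + _](bigD1 w) //= vw mul1n -addnA leq_add2l big_distrl /=.
have -> : (e v b && (b != w)) * (k - degree b) =
    \sum_(u | u != w) e v u * (u == b) * (k - degree b).
  case: (eqVneq b w) => [->|bw].
    by rewrite andbF big1 // => u /negbTE ->; rewrite muln0.
  rewrite andbT (bigD1 b) //= eqxx muln1 big1 ?addn0 // => u /andP[_ /negbTE->].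
  by rewrite muln0.
rewrite -big_split; apply: leq_sum => u _ /=.
case: (e v u) => //=; rewrite !mul1n.
case: (eqVneq u b) => [->|ub] /=; first by lia.
by have := kmin _ ub; lia.
Qed.

(** The Moore bound with both ends estimated by [sum_neighbors]. If [v] is [b], there is no
    shortfall. Otherwise [b], which cannot be adjacent to both ends for lack of triangles, costs at
    most [k - degree b], and the excess of [degree v] over [degree b] covers this. *)
Lemma edge_bound b k v w :
  (forall u, u != b -> k <= degree u) -> (forall u, degree b <= degree u) ->
  1 < degree b <= k -> e v w -> w != b ->
  (degree b + degree w - 2) * k + 2 <= #|T|.
Proof.
move=> kmin bmin /andP[b_gt1 bk] vw wb.
have wv : e w v by rewrite (cg_sym G).
have := moore_edge vw.
have := sum_neighbors kmin vw; have := sum_neighbors kmin wv.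
have kw := kmin _ wb.
case: (eqVneq v b) => [->|vb].
  rewrite (cg_irr G) /= andbF !mul0n !addn0; nia.
have kv := kmin _ vb.
rewrite /= andbT.
have -> : e v b && (b != w) = e v b by rewrite eq_sym wb andbT.
have : ~~ (e v b && e w b).
  apply/negP=> /andP[vb' wb']; apply: (cg_tri G vw wb').
  by rewrite (cg_sym G).
by case: (e v b); case: (e w b) => //= _; rewrite ?mul1n ?mul0n; nia.
Qed.

End GraphSide.

(* [bad] is the 1-cell of an odd structure: the only pair that need not share a
   signed color. *)
Record linked (A B S : finType) (eA : rel A) (eB : rel B) (IA : A -> S -> bool)
    (IB : B -> S -> bool) (bar : S -> S) (mateA : S -> A -> A)
    (mateB : S -> B -> B) (bad : A -> B -> bool) : Prop := Linked {
  lkA : colored_graph eA IA bar mateA;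
  lkB : colored_graph eB IB bar mateB;
  lk_bar : forall s, bar s != s;
  lk_mixed : forall a b s t, IA a s -> IB b s -> IA a t -> IB b t -> s = t;
  lk_meet : forall a b, bad a b \/ exists s, IA a s && IB b s;
  lk_bad : forall a b a' b', bad a b -> bad a' b' -> a = a' /\ b = b';
  lk_cardA : 1 < #|A|;
  lk_cardB : 1 < #|B| }.

Lemma linked_swap A B S eA eB IA IB bar mateA mateB bad :
  @linked A B S eA eB IA IB bar mateA mateB bad ->
  linked eB eA IB IA bar mateB mateA (fun b a => bad a b).
Proof.
case=> GA GB barN mixed meet bad1 cA cB; split=> //.
- by move=> b a s t bs as_ bt at_; apply: (mixed a b).
- move=> b a; case: (meet a b) => [->|[s ab]]; first by left.
  by right; exists s; rewrite andbC.
- by move=> b a b' a' ab ab'; case: (bad1 _ _ _ _ ab ab').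
Qed.

(** * Weights of signed colors and vertices of low degree *)

Section Linked.

Variables (A B S : finType) (eA : rel A) (eB : rel B) (IA : A -> S -> bool).
Variables (IB : B -> S -> bool) (bar : S -> S) (mateA : S -> A -> A).
Variables (mateB : S -> B -> B) (bad : A -> B -> bool).

Hypothesis L : linked eA eB IA IB bar mateA mateB bad.

Let GA := lkA L.
Let GB := lkB L.

Definition weight s := \sum_a IA a s.
(** Correction for the 1-cell: it counts the vertices that may fail to share a signed color with
    [b]. *)
Definition defect b := \sum_a bad a b.

Lemma defect_le1 b : defect b <= 1.
Proof.
by apply: sum_bool_le1 => a a' ab ab'; case: (lk_bad L ab ab').
Qed.

Lemma defectD_le1 b b' : b != b' -> defect b + defect b' <= 1.
Proof.
move=> bb'; rewrite -big_split /=.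
case: (pickP (fun a => bad a b || bad a b')) => [a0 bad0|bad0].
  rewrite (bigD1 a0) //= big1 => [|a aa0].
    rewrite addn0; case ab: (bad a0 b); case ab': (bad a0 b') => //=.
    by case: (lk_bad L ab ab') => _ E; rewrite E eqxx in bb'.
  apply/eqP; rewrite addn_eq0 !eqb0; apply/andP; split; apply/negP => ab;
    by case/orP: bad0 => /(lk_bad L ab)[E _]; rewrite E eqxx in aa0.
by rewrite big1 // => a _; move: (bad0 a); case: (bad a b); case: (bad a b').
Qed.

Lemma meet_count a b : 1 <= bad a b + \sum_s IB b s * IA a s.
Proof.
case: (lk_meet L a b) => [->//|[s /andP[as_ bs]]].
by rewrite (bigD1 s) //= as_ bs addnCA.
Qed.

Lemma card_le_weights b : #|A| <= defect b + \sum_s IB b s * weight s.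
Proof.
have -> : \sum_s IB b s * weight s = \sum_a \sum_s IB b s * IA a s.
  by rewrite exchange_big; apply: eq_bigr => s _; rewrite big_distrr.
by rewrite -big_split -sum1_card; apply: leq_sum => a _; apply: meet_count.
Qed.

(* The vertices of signed color [s] meet [b] in different signed colors. *)
Lemma weight_le_color b s : ~~ IB b s ->
  weight s <= \sum_a IA a s * bad a b + \sum_t IB b t.
Proof.
move=> bs.
apply: (@leq_trans (\sum_a (IA a s * bad a b + \sum_t IB b t * (IA a s * IA a t)))).
  apply: leq_sum => a _; case: (IA a s) => //; rewrite mul1n.
  by apply: leq_trans (meet_count a b) _; rewrite leq_add2l leq_sum // => t _; lia.
rewrite big_split leq_add2l /= exchange_big; apply: leq_sum => t _.
rewrite -big_distrr /=; case bt: (IB b t) => //; rewrite mul1n.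
under eq_bigr => a _ do rewrite mulnb.
apply: sum_bool_le1 => a a' /andP[as_ at_] /andP[as' at'].
case: (eqVneq a a') => // aa'; move: bs.
by rewrite (cg_linear GA aa' as_ as' at_ at') bt.
Qed.

Lemma weight_le_degree b s : ~~ IB b s ->
  weight s <= \sum_a IA a s * bad a b + degree eB b.
Proof.
move/weight_le_color/leq_trans; apply.
by rewrite leq_add2l (color_le_degree GB).
Qed.

(** As [s] and [bar s] are distinct, linearity allows at most one vertex on both. *)
Lemma weight_bar s : weight s + weight (bar s) <= #|A| + 1.
Proof.
rewrite -big_split /=.
have le1 : \sum_a (IA a s && IA a (bar s)) <= 1.
  apply: sum_bool_le1 => a a' /andP[as_ abs] /andP[as' abs'].
  case: (eqVneq a a') => // aa'; case/eqP: (lk_bar L s).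
  by rewrite -(cg_linear GA aa' as_ as' abs abs').
apply: (@leq_trans (\sum_a (1 + (IA a s && IA a (bar s))))).
  by apply: leq_sum => a _; case: (IA a s); case: (IA a (bar s)).
by rewrite big_split /= sum1_card leq_add2l.
Qed.

(** Such a [b] carries at most one signed color [s], so up to the defect all of [A] lies on [s]. But
    [mateA] embeds the vertices of [s] into those of [bar s], so twice the weight of [s] is at most
    [#|A| + 1]. *)
Lemma low_degree b : degree eB b <= 1 ->
  #|A| + #|A| <= #|A| + 1 + defect b + defect b.
Proof.
move=> deg_b; have := card_le_weights b.
have deg_I : \sum_s IB b s <= 1 := leq_trans (color_le_degree GB b) deg_b.
have := lk_cardA L; case: (pickP (IB b)) => [s bs|b0].
  rewrite (bigD1 s) //= bs big1 => [|t ts].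
    rewrite mul1n addn0; have := weight_bar s.
    have : weight s <= weight (bar s) := card_bar GA s.
    by move: #|A| => m; lia.
  move: deg_I; rewrite (bigD1 s) // (bigD1 t) //= bs.
  by case: (IB b t).
rewrite big1 => [|s _]; last by rewrite b0.
by have := defect_le1 b; lia.
Qed.

Lemma degree_gt1_regular b : defect b = 0 -> 1 < degree eB b.
Proof.
move=> d0; rewrite ltnNge; apply/negP=> /low_degree.
by rewrite d0; have := lk_cardA L; lia.
Qed.

End Linked.

(** * Comparison of the sizes of the two sides *)

Section Inequality.

Variables (A B S : finType) (eA : rel A) (eB : rel B) (IA : A -> S -> bool).
Variables (IB : B -> S -> bool) (bar : S -> S) (mateA : S -> A -> A).
Variables (mateB : S -> B -> B) (bad : A -> B -> bool).

Hypothesis L : linked eA eB IA IB bar mateA mateB bad.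

Let GA := lkA L.
Let GB := lkB L.

(** By [low_degree], a counterexample [b] lies in the 1-cell and [A] has at most 3 vertices. Then
    every vertex of [A] other than [a0] has degree at least 2, and the Moore bound at an edge
    avoiding [a0] produces 4 vertices. *)
Lemma degree_gt1 b : 1 < degree eB b.
Proof.
rewrite ltnNge; apply/negP=> deg_b; have := low_degree L deg_b.
have := defect_le1 L b; case: (posnP (defect bad b)) => [d0|d_gt0 d_le1].
  by have := degree_gt1_regular L d0; rewrite ltnNge deg_b.
have d1 : defect bad b = 1 by lia.
move=> cardA; have {cardA} cardA : #|A| <= 3 by lia.
have [a0 bad0] : exists a0, bad a0 b.
  apply/existsP; move: d_gt0; apply: contraTT => /existsPn bad0.
  by rewrite -leqNgt leqn0 /defect big1 // => a _; rewrite (negbTE (bad0 a)).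
have degA a : a != a0 -> 1 < degree eA a.
  move=> aa0; apply: (degree_gt1_regular (linked_swap L)).
  rewrite /defect big1 // => b' _; case ab: (bad a b') => //.
  by case: (lk_bad L ab bad0) => E; rewrite E eqxx in aa0.
have [a aa0] : exists a, a != a0.
  apply/existsP; have := lk_cardA L; apply: contraTT => /existsPn eq0.
  rewrite -leqNgt; apply: leq_trans (_ : #|pred1 a0| <= 1); last by rewrite card1.
  by apply: subset_leq_card; apply/subsetP => a _; have := eq0 a; rewrite negbK.
have dega := degA _ aa0.
have [w aw wa0] : exists2 w, eA a w & w != a0.
  have [w /andP[aw wa0]] : exists w, eA a w && (w != a0).
    apply/existsP; move: dega; apply: contraTT => /existsPn nw.
    rewrite -leqNgt; apply: sum_bool_le1 => u v au av.
    by have := nw u; have := nw v; rewrite au av !negbK => /eqP-> /eqP->.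
  by exists w.
have degw := degA _ wa0; have wa : eA w a by rewrite (cg_sym GA).
have := moore_edge GA aw; rewrite (bigD1 w) //= [X in _ + X <= _](bigD1 a) //=.
by rewrite aw wa !mul1n; move: #|A| cardA dega degw => m; lia.
Qed.

Theorem card_lt : #|A| < #|B|.
Proof.
have [b0 _] : exists b : B, true.
  have := lk_cardB L.
  by case: (pickP (fun b : B => true)) => [b|/eq_card0->] //; exists b.
have [b _ bmin] := arg_minnP (degree eB) (erefl true : xpredT b0).
have bmin' u : degree eB b <= degree eB u by apply: bmin.
have [b1 b1b] : exists b1, b1 != b.
  apply/existsP; have := lk_cardB L; apply: contraTT => /existsPn eqb.
  rewrite -leqNgt; apply: leq_trans (_ : #|pred1 b| <= 1); last by rewrite card1.
  by apply: subset_leq_card; apply/subsetP => u _; have := eqb u; rewrite negbK.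
have [b2 /= b2b b2min] := arg_minnP (degree eB) (b1b : [pred u | u != b] b1).
have b2min' u : u != b -> degree eB b2 <= degree eB u by apply: b2min.
set t := degree eB b in bmin'; set k := degree eB b2 in b2min'.
have t_gt1 : 1 < t := degree_gt1 b.
have tk : t <= k by apply: bmin'.
have bound v w : eB v w -> w != b -> (t + degree eB w - 2) * k + 2 <= #|B|.
  by move=> vw wb; apply: (edge_bound GB) vw wb; rewrite ?t_gt1.
have deg_b : \sum_s IB b s <= t := color_le_degree GB b.
(* A vertex [a] shares at most one signed color with [b], so over all signed colors at [b] the
   correction for the 1-cell at [b2] is paid only once. *)
have badb2 (P : pred S) :
    \sum_(s | P s) IB b s * (\sum_a IA a s * bad a b2) <= defect bad b2.
  apply: (@leq_trans (\sum_s IB b s * (\sum_a IA a s * bad a b2))).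
    by rewrite [leqRHS](bigID P) leq_addr.
  under eq_bigr => s _ do rewrite big_distrr.
  rewrite exchange_big; apply: leq_sum => a _ /=.
  have : \sum_s (IB b s && IA a s) <= 1.
    apply: sum_bool_le1 => s s' /andP[bs as_] /andP[bs' as'].
    exact: (lk_mixed L as_ bs).
  case: (bad a b2) => [|_]; last by rewrite big1 // => s _; lia.
  under eq_bigr => s _ do rewrite -mulnb.
  by under [in X in _ -> X]eq_bigr => s _ do rewrite muln1.
have bad2 := defectD_le1 L b2b.
have cardA := card_le_weights L b.
have weight_off s : ~~ IB b2 s ->
    IB b s * weight IA s <= IB b s * (\sum_a IA a s * bad a b2) + IB b s * k.
  by move=> /(weight_le_degree L); rewrite -mulnDr; apply: leq_mul.
(* If [b] and [b2] share no signed color, each of the at most [t] signed colors at [b] has weight at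
   most [k] up to the defect, so [#|A|] is at most [t * k + 1], while an edge at [b] forces [#|B|]
   to be at least [t * k + 2]. *)
case: (pickP (fun s => IB b s && IB b2 s)) => [s /andP[bs b2s]|no_s]; last first.
  have [w bw wb] : exists2 w, eB b w & w != b.
    have [w bw] : exists w, eB b w.
      apply/existsP; move: t_gt1; apply: contraTT => /existsPn nw.
      by rewrite /t /degree big1 // => u _; rewrite (negbTE (nw u)).
    by exists w => //; apply: contraTneq bw => ->; rewrite (cg_irr GB).
  have := bound _ _ bw wb; have := b2min' _ wb.
  have : \sum_s IB b s * weight IA s <= defect bad b2 + t * k.
    apply: leq_trans (leq_add (badb2 predT) (leq_mul deg_b (leqnn k))).
    rewrite big_distrl -big_split; apply: leq_sum => s _ /=.
    have := no_s s; have := weight_off s; case: (IB b s) => //= off b2s.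
    by apply: off; rewrite b2s.
  have := leq_mul (_ : t <= t + degree eB w - 2) (leqnn k).
  by move: #|A| #|B| cardA => m n; move: (degree eB w) => D; lia.
(* By linearity [s] is the only signed color common to [b] and [b2]; the other signed colors at [b],
   at most [t - 1] in number, fall under [weight_off]. *)
have sumA : \sum_s IB b s * weight IA s <= weight IA s + defect bad b2 + t.-1 * k.
  rewrite (bigD1 s) //= bs mul1n -addnA leq_add2l.
  have le_t : \sum_(s' | s' != s) IB b s' <= t.-1.
    by move: deg_b; rewrite (bigD1 s) //= bs; lia.
  apply: leq_trans (leq_add (badb2 (predC1 s)) (leq_mul le_t (leqnn k))).
  rewrite big_distrl -big_split; apply: leq_sum => s' s's /=.
  have := weight_off s'; case bs': (IB b s') => // off; apply: off.
  apply/negP=> b2s'; case/eqP: s's.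
  exact: (cg_linear GB b2b b2s' bs' b2s bs).
(* The neighbors of [b] and [b2] along [s] are distinct vertices of signed color
   [bar s], and [s] and [bar s] have at most one vertex in common. *)
have [v [w [vw nws]]] : exists v w, eB v w /\ ~~ IB w s.
  case: (boolP (IB (mateB s b) s)) => [ws|ws]; last first.
    by exists b, (mateB s b); rewrite (cg_adj GB).
  exists b2, (mateB s b2); rewrite (cg_adj GB) //; split=> //; apply/negP=> w2s.
  case: (eqVneq (mateB s b2) (mateB s b)) => [/(cg_injl GB b2s bs)E|ne].
    by rewrite E eqxx in b2b.
  case/eqP: (lk_bar L s).
  by rewrite -(cg_linear GB ne w2s ws (cg_bar GB b2s) (cg_bar GB bs)).
have wb : w != b by apply: contraNneq nws => ->.
have wb2 : w != b2 by apply: contraNneq nws => ->.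
have := bound _ _ vw wb; have := weight_le_degree L nws.
have : \sum_a IA a s * bad a w <= defect bad w.
  by apply: leq_sum => a _; case: (IA a s); rewrite ?mul1n.
have := degree_gt1 w.
(* The three pairwise bounds make twice this sum at most 3. *)
have : defect bad b + defect bad b2 + defect bad w <= 1.
  have := defectD_le1 L wb; have := defectD_le1 L wb2.
  by move: bad2; lia.
move: #|A| #|B| cardA sumA => m n; rewrite -/k.
move: (\sum_s0 IB b s0 * _) => sum_b; move: (degree eB w) => D.
(* Now [#|A|] is at most [(t - 1) * k + D + 1] and [#|B|] at least [(t - 1) * k + (D - 1) * k + 2],
   where [(D - 1) * k >= D] since [D] and [k] are at least 2. *)
by nia.
Qed.

End Inequality.

Lemma not_linked A B S eA eB IA IB bar mateA mateB bad :
  ~ @linked A B S eA eB IA IB bar mateA mateB bad.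
Proof.
move=> L; have := ltn_trans (card_lt L) (card_lt (linked_swap L)).
by rewrite ltnn.
Qed.

(** * Graphs without short cycles *)

Lemma has_cycle_seq (G : sgraph) (c : seq G) :
  2 < size c -> ucycle (@adj G) c -> has_cycle G (size c).
Proof.
move=> c_gt2 cyc; rewrite /has_cycle c_gt2; apply/existsP.
by exists (in_tuple c).
Qed.

Lemma has_cycleP (G : sgraph) k :
  has_cycle G k -> exists c : seq G, size c = k /\ ucycle (@adj G) c.
Proof. by case/andP=> _ /existsP[c cyc]; exists c; rewrite size_tuple. Qed.

Lemma bipartite_even (G : sgraph) (side : G -> bool) k :
  (forall x y, adj x y -> side x != side y) -> has_cycle G k -> ~~ odd k.
Proof.
move=> bip /has_cycleP[[|x c] [<- /andP[cyc _]]] //.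
have walk p y : path (@adj G) y p -> side (last y p) = side y (+) odd (size p).
  elim: p y => [|z p IH] y /=; first by rewrite addbF.
  by case/andP=> /bip yz /IH->; case: (side y) (side z) yz => [] [] // _; case: odd.
have := walk _ _ cyc; rewrite last_rcons size_rcons.
by rewrite /=; case: (side x); case: odd.
Qed.

Lemma has_cycle_bounds (G : sgraph) k : has_cycle G k -> 2 < k <= #|G|.
Proof.
case/andP=> -> /existsP[c /andP[_ /card_uniqP cK]].
by rewrite -[k in k <= _](size_tuple c) -cK max_card.
Qed.

Lemma girth_eq (G : sgraph) g :
  has_cycle G g -> (forall k, k < g -> ~~ has_cycle G k) -> girth G = Some g.
Proof.
move=> cg cmin; have /andP[_ gG] := has_cycle_bounds cg.
(* The start of the searched range is generalized for the induction on its length. *)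
have first m n : m <= g -> g < m + n ->
    ohead [seq k <- iota m n | has_cycle G k] = Some g.
  elim: n m => [|n IH] m mg gmn; first by lia.
  rewrite /=; case: (eqVneq m g) => [->|neq]; first by rewrite cg.
  have mlt : m < g by lia.
  by rewrite (negbTE (cmin m mlt)) IH //; lia.
by apply: first.
Qed.

Lemma girth_ge_no_cycle (G : sgraph) p k :
  girth_ge G p -> k < p -> ~~ has_cycle G k.
Proof.
move=> Gp kp; apply/negP=> ck.
have ex_c : exists k, has_cycle G k by exists k.
have [g cg gmin] := ex_minnP ex_c.
have gG : girth G = Some g.
  by apply: girth_eq => // j jg; apply/negP=> /gmin; rewrite leqNgt jg.
by move: Gp; rewrite /girth_ge gG leqNgt (leq_ltn_trans (gmin _ ck) kp).
Qed.

Section BipartiteCycles.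

Variables (T S : finType) (inc : T -> S -> bool).

Lemma bip_hexagon v1 v2 v3 s12 s23 s31 :
  [/\ v1 != v2, v2 != v3 & v3 != v1] -> [/\ s12 != s23, s23 != s31 & s31 != s12] ->
  [/\ inc v1 s12, inc v2 s23 & inc v3 s31] ->
  [/\ inc v2 s12, inc v3 s23 & inc v1 s31] ->
  has_cycle (bipartite_graph inc) 6.
Proof.
move=> [v12 v23 v31] [s12_23 s23_31 s31_12] [h1 h2 h3] [h4 h5 h6].
pose c : seq (bipartite_graph inc) :=
  [:: inl v1; inr s12; inl v2; inr s23; inl v3; inr s31].
apply: (@has_cycle_seq _ c) => //.
rewrite /ucycle /= h1 h2 h3 h4 h5 h6 !inE /= !(inj_eq inl_inj, inj_eq inr_inj).
by rewrite !negb_or /= v12 v23 s12_23 s23_31 !(eq_sym v1) v31 !(eq_sym s12) s31_12.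
Qed.

Lemma bip_no_square :
  (forall v w s t, v != w -> inc v s -> inc w s -> inc v t -> inc w t -> s = t) ->
  ~~ has_cycle (bipartite_graph inc) 4.
Proof.
move=> lin; apply/negP=> /has_cycleP[c [c4 /andP[cyc uc]]].
case: c c4 cyc uc => [|x1 [|x2 [|x3 [|x4 []]]]] //= _.
rewrite !inE !negb_or !andbT.
case: x1 x2 x3 x4 => [v|x] [w|y] [v'|x'] [w'|y'] //=; rewrite ?andbF //.
  case/and4P=> vy v'y v'y' vy' /andP[/andP[vv' _] /andP[/eqP yy' _]].
  by apply: yy'; rewrite (lin v v' y y').
case/and4P=> wx wx' w'x' w'x /andP[/andP[/eqP xx' _] /andP[ww' _]].
by apply: xx'; rewrite (lin w w' x x').
Qed.

End BipartiteCycles.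

Section ShortCycles.

Variable G : sgraph.
Local Notation e := (@adj G).

Lemma adj_neq (x y : G) : e x y -> x != y.
Proof. by apply: contraTneq => ->; rewrite adj_irr. Qed.

Lemma no_triangle (x y z : G) :
  ~~ has_cycle G 3 -> e x y -> e y z -> e z x -> False.
Proof.
move=> n3 xy yz zx; case/negP: n3; apply: (@has_cycle_seq _ [:: x; y; z]) => //.
rewrite /ucycle /= xy yz zx !inE !negb_or (adj_neq xy) (adj_neq yz).
by rewrite eq_sym (adj_neq zx).
Qed.

Lemma no_square (x y u v : G) : ~~ has_cycle G 4 ->
  x != y -> e x u -> e u y -> e x v -> e v y -> u = v.
Proof.
move=> n4 xy xu uy xv vy; apply/eqP; apply: contraNT n4 => uv.
apply: (@has_cycle_seq _ [:: x; u; y; v]) => //.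
rewrite /ucycle /= xu uy (adj_sym y) vy (adj_sym v) xv !inE !negb_or.
by rewrite (adj_neq xu) xy (adj_neq xv) (adj_neq uy) uv (eq_sym y) (adj_neq vy).
Qed.

(** This covers all closed walks of length 5: if two vertices two steps apart coincide, the other
    three edges form a triangle. *)
Lemma no_pentagon (x y z u v : G) : ~~ has_cycle G 3 -> ~~ has_cycle G 5 ->
  e x y -> e y z -> e z u -> e u v -> e v x -> False.
Proof.
move=> n3 n5 xy yz zu uv vx.
have chord (a b c d f : G) :
    e a b -> e b c -> e c d -> e d f -> e f a -> a != c.
  move=> ab bc cd df fa; apply/eqP=> ac.
  by rewrite -ac in cd; apply: (no_triangle n3 cd df fa).
case/negP: n5; apply: (@has_cycle_seq _ [:: x; y; z; u; v]) => //.
rewrite /ucycle /= xy yz zu uv vx !inE !negb_or.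
rewrite (adj_neq xy) (adj_neq yz) (adj_neq zu) (adj_neq uv).
rewrite (eq_sym x v) (adj_neq vx) (chord x y z u v) // (chord y z u v x) //.
rewrite (chord z u v x y) // (eq_sym x u) (chord u v x y z) //.
by rewrite (eq_sym y v) (chord v x y z u).
Qed.

End ShortCycles.

(** * Colors as classes of edges *)

Section Colors.

Variable Pi : product_structure.

Lemma same_color_sym : connect_sym
  (fun e f : {set LAB Pi} => color_step e f || color_step f e).
Proof. by apply: sym_connect_sym => e f; rewrite orbC. Qed.

Lemma mem_edges (G : sgraph) (v w : G) : adj v w -> [set v; w] \in edges G.
Proof. by move=> vw; apply/imsetP; exists (v, w); rewrite ?inE. Qed.

Lemma mem_color (c : color Pi) e f : e \in val c ->
  (f \in val c) = (f \in edges (LAB Pi)) && same_color e f.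
Proof.
case: c => c /= /imsetP[e0 _ ->]; rewrite !inE => /andP[_ e0e].
by rewrite /same_color (same_connect same_color_sym e0e).
Qed.

Lemma color_inj (c d : color Pi) e : e \in val c -> e \in val d -> c = d.
Proof.
by move=> ec ed; apply/val_inj/setP => f; rewrite (mem_color f ec) (mem_color f ed).
Qed.

Lemma edge_color e : e \in edges (LAB Pi) -> exists c : color Pi, e \in val c.
Proof.
move=> e_in; have cP : [set f in edges (LAB Pi) | same_color e f] \in colors Pi.
  by apply: imset_f.
exists (exist (fun c => c \in colors Pi) _ cP).
by rewrite inE e_in /=; apply: connect0.
Qed.

End Colors.

(** * Obstruction at girth 6 *)

Section Obstruction.

Variables (Pi : product_structure) (O : rel (LAB Pi)).
Hypothesis coh : coherent O.
Hypothesis nf : no_fold O.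
Hypothesis g6 : girth_ge (LAB Pi) 6.
Hypothesis h6 : girth_ge (L1 O) 6.

Local Notation V := (LAB Pi).
Local Notation scolor := (color Pi * bool)%type.

(** An edge read from its end [v]: outgoing for the sign [true], incoming for [false]. Reading it
    from the other end changes the sign. *)
Definition arc (s : scolor) (v w : V) :=
  if s.2 then out_edge O s.1 v w else out_edge O s.1 w v.

Lemma signed_incE v s : signed_inc O v s = [exists w, arc s v w].
Proof. by rewrite /signed_inc /arc; case: s.2. Qed.

Lemma arc_adj s v w : arc s v w -> adj v w.
Proof.
case: coh => -[Oadj _] _.
by rewrite /arc; case: s.2 => /andP[/Oadj]; rewrite // adj_sym.
Qed.

Lemma arc_bar s v w : arc s v w -> arc (s.1, ~~ s.2) w v.
Proof. by rewrite /arc /=; case: s.2. Qed.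

Lemma arc_injl s v v' w : arc s v w -> arc s v' w -> v = v'.
Proof.
have [out_inj in_inj] := nf s.1 w v v'.
by rewrite /arc; case: s.2; [apply: in_inj | apply: out_inj].
Qed.

(** The edge determines its color, and its direction determines the sign. *)
Lemma arc_injs s t v w : arc s v w -> arc t v w -> s = t.
Proof.
case: coh => -[Oadj Oanti] _; case: s t => [c i] [d j]; rewrite /arc /=.
have cd : [set v; w] \in val c -> [set v; w] \in val d -> c = d.
  exact: color_inj.
case: i; case: j => /andP[vw wc] /andP[vw' wd]; rewrite ?(setUC [set w]) in wc wd;
  rewrite (cd wc wd) //.
- by have := Oanti _ _ (Oadj _ _ vw); rewrite vw vw'.
- by have := Oanti _ _ (Oadj _ _ vw); rewrite vw vw'.
Qed.

(** Two common signed colors would form a 4-cycle of [L1] with [v] and [w]. *)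
Lemma signed_linear v w s t : v != w -> signed_inc O v s -> signed_inc O w s ->
  signed_inc O v t -> signed_inc O w t -> s = t.
Proof.
move=> vw vs ws vt wt; have n4 := girth_ge_no_cycle h6 (isT : 4 < 6).
by case: (@no_square (L1 O) (inl v) (inl w) (inr s) (inr t) n4 vw vs ws vt wt).
Qed.

Section Side.

Variables (T : finType) (h : T -> V).
Hypothesis h_inj : injective h.
Hypothesis h_closed : forall x w, adj (h x) w -> exists y, w = h y.

(** The default [x] is reached only when [s] is not a signed color at [x]; otherwise no-fold makes
    the target unique. *)
Definition side_mate s x := odflt x [pick y | arc s (h x) (h y)].

Lemma side_mateP x s : signed_inc O (h x) s -> arc s (h x) (h (side_mate s x)).
Proof.
rewrite signed_incE => /existsP[w xw].
have [y Ew] := h_closed (arc_adj xw); rewrite /side_mate.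
by case: pickP => //= /(_ y); rewrite -Ew xw.
Qed.

(** To be used with [h] equal to [inl] and to [inr]. The girth of [LAB] excludes the short closed
    walks, the girth of [L1] gives linearity, and no-fold makes [side_mate s] injective on the
    vertices of [s]. *)
Lemma colored_side :
  colored_graph (fun x y => adj (h x) (h y)) (fun x => signed_inc O (h x))
    (fun s => (s.1, ~~ s.2)) side_mate.
Proof.
have n3 := girth_ge_no_cycle g6 (isT : 3 < 6).
have n4 := girth_ge_no_cycle g6 (isT : 4 < 6).
have n5 := girth_ge_no_cycle g6 (isT : 5 < 6).
split.
- by move=> x y; rewrite adj_sym.
- by move=> x; rewrite adj_irr.
- by move=> x y z; apply: no_triangle.
- move=> x y u v xy xu uy xv vy; apply: h_inj; apply: (no_square n4) xu uy xv vy.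
  by rewrite (inj_eq h_inj).
- by move=> x y z u v; apply: no_pentagon.
- by move=> x y s t xy; apply: signed_linear; rewrite (inj_eq h_inj).
- by move=> x s /side_mateP/arc_adj.
- move=> x s /side_mateP/arc_bar xs; rewrite signed_incE.
  by apply/existsP; exists (h x).
- move=> x y s /side_mateP xs /side_mateP ys E; apply: h_inj.
  by rewrite E in xs; apply: arc_injl xs ys.
- move=> x s t /side_mateP xs /side_mateP xt E.
  by rewrite E in xs; apply: arc_injs xs xt.
Qed.

End Side.

(** Both edges of the cell have the same color, and coherence makes [a] and [b] both tails or both
    heads. *)
Lemma two_cell_signed a a' b b' : two_cell (a, b) (a', b') ->
  exists s, signed_inc O (inl a : V) s && signed_inc O (inr b : V) s.
Proof.
move=> cell; case: coh => -[Oadj _] /(_ _ _ _ _ cell) Ocell.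
have step : color_step [set (inl a : V); inl a'] [set (inr b : V); inr b'].
  by apply/existsP; exists (a, b); apply/existsP; exists (a', b'); rewrite cell !eqxx.
have edA : [set (inl a : V); inl a'] \in edges V.
  case: Ocell => -[/Oadj aa' _]; first exact: mem_edges.
  by rewrite setUC; apply: mem_edges.
have edB : [set (inr b : V); inr b'] \in edges V.
  case: Ocell => -[_ /Oadj bb']; first exact: mem_edges.
  by rewrite setUC; apply: mem_edges.
have [c ac] := edge_color edA.
have bc : [set (inr b : V); inr b'] \in val c.
  by rewrite (mem_color _ ac) edB; apply: connect1; rewrite step.
case: Ocell => -[aa' bb'].
  exists (c, true); apply/andP; split; apply/existsP.
    by exists (inl a'); rewrite /out_edge aa'.
  by exists (inr b'); rewrite /out_edge bb'.
exists (c, false); apply/andP; split; apply/existsP.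
  by exists (inl a'); rewrite /out_edge aa' setUC.
by exists (inr b'); rewrite /out_edge bb' setUC.
Qed.

Hypothesis eo : even_or_odd Pi.
Hypothesis cA : 2 <= #|psA Pi|.
Hypothesis cB : 2 <= #|psB Pi|.

Lemma cell_mate z : [set z] \notin cells Pi -> exists z', two_cell z z'.
Proof.
move=> nz; have /and3P[/eqP cov _ n0] := cells_partition Pi.
have : z \in cover (cells Pi) by rewrite cov inE.
case/bigcupP=> C Cc zC.
have C2 : #|C| = 2.
  case: eo => [ev|[C0 [C0c C01 ev]]]; first exact: ev.
  apply: ev => // E; case/negP: nz; move: zC; rewrite E.
  have /cards1P[x Ex] : #|C0| == 1 by rewrite C01.
  by rewrite Ex inE => /eqP->; rewrite -Ex.
have /cards2P[x [y [xy E]]] : #|C| == 2 by rewrite C2.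
move: zC Cc; rewrite E !inE => /orP[] /eqP-> Cc.
  by exists y; rewrite /two_cell xy.
by exists x; rewrite /two_cell eq_sym xy setUC.
Qed.

Lemma girth6_absurd : False.
Proof.
pose bad a b := [set (a, b)] \in cells Pi.
have hA (x : psA Pi) (w : V) : adj (inl x : V) w -> exists y, w = inl y.
  by case: w => [y _|//]; exists y.
have hB (x : psB Pi) (w : V) : adj (inr x : V) w -> exists y, w = inr y.
  by case: w => [//|y _]; exists y.
apply: (@not_linked _ _ _ _ _ _ _ _ _ _ bad).
apply: (@Linked _ _ _ _ _ _ _ _ _ _ _
  (@colored_side _ inl inl_inj hA) (@colored_side _ inr inr_inj hB)) => //.
- by move=> [c i]; rewrite xpair_eqE /=; case: i; rewrite andbF.
- by move=> a b s t; apply: signed_linear.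
- move=> a b; case: (boolP (bad a b)) => [|/cell_mate[[a' b']]]; first by left.
  by move/two_cell_signed; right.
- move=> a b a' b' ab ab'; case: eo => [ev|[C0 [C0c C01 ev]]].
    by have := ev _ ab; rewrite cards1.
  have E x y : bad x y -> [set (x, y)] = C0.
    by move=> xy; apply/eqP; apply: contraT => /eqP /(ev _ xy); rewrite cards1.
  by have /set1_inj[-> ->] := etrans (E _ _ ab) (esym (E _ _ ab')).
Qed.

End Obstruction.

Lemma obstructed6 : obstructed 6.
Proof.
by case=> Pi [O [eo [cA cB] [coh nf] g6 h6]]; apply: (@girth6_absurd Pi O).
Qed.

(** * The code construction *)

Section Construction.

Import GRing.Theory.
Local Open Scope ring_scope.

Variables (F : finFieldType) (lam : F).
Hypothesis F_char2 : forall x : F, x + x = 0.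
Hypothesis lam0 : lam != 0.
Hypothesis lam1 : lam != 1.

Local Notation word := (F * F)%type.
Local Notation A := (bool * F)%type.
Local Notation V := (A + A)%type.

(* Words are stored as (x, y); coordinate (p, i) lives on side i of A
   (p = false) or of B (p = true). *)
Definition coord (i : bool * bool) (s : word) : F :=
  match i with
  | (false, false) => s.1
  | (false, true) => s.2
  | (true, false) => s.1 + s.2
  | (true, true) => s.1 + lam * s.2
  end.

(** The word (1, 0, 1, 1) is stored as (1, 0). *)
Definition flip (s : word) : word := (s.1 + 1, s.2).

Lemma flipK : involutive flip.
Proof. by case=> x y; rewrite /flip /= -addrA F_char2 addr0. Qed.

Lemma flip_neq s : flip s != s.
Proof.
case: s => x y; rewrite xpair_eqE eqxx andbT -subr_eq0 /= addrAC subrr add0r.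
exact: oner_neq0.
Qed.

Lemma coordB i s t : coord i (s.1 - t.1, s.2 - t.2) = coord i s - coord i t.
Proof.
case: i => [[] []] //=; first by rewrite mulrBr addrACA opprD.
by rewrite addrACA opprD.
Qed.

Lemma coord_flip i s t : coord i (flip s) = coord i (flip t) -> coord i s = coord i t.
Proof.
move/eqP; rewrite -subr_eq0 -coordB /= opprD addrACA subrr addr0 coordB subr_eq0.
by move/eqP.
Qed.

(** The coordinates are pairwise independent linear forms: [x] and [x + lam * y] because [lam] is
    nonzero, [x + y] and [x + lam * y] because [lam] differs from 1. *)
Lemma coord_ker i j x y :
  i != j -> coord i (x, y) = 0 -> coord j (x, y) = 0 -> (x, y) = (0, 0).
Proof.
have lam1' : lam - 1 != 0 by rewrite subr_eq0.
have y0P c : c != 0 -> c * y = 0 -> y = 0.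
  by move=> c0 /eqP; rewrite mulf_eq0 (negbTE c0) => /eqP.
have xy : x + y = 0 -> x + lam * y = 0 -> y = 0.
  move=> h1 h2; apply: (y0P (lam - 1)) => //.
  by rewrite -[RHS](subrr 0) -{1}h2 -h1 opprD addrACA subrr add0r mulrBl mul1r.
have ker : (x = 0 \/ y = 0) -> x + y = 0 \/ x + lam * y = 0 -> (x, y) = (0, 0).
  case=> ->; rewrite ?mulr0 ?add0r ?addr0; last by case=> ->.
  by case=> [->//|/(y0P _ lam0)->].
case: i => [[] []]; case: j => [[] []] //= _ h1 h2; try (by rewrite h1 h2);
  apply: ker; auto.
Qed.

Lemma coord_inj i j s t :
  i != j -> coord i s = coord i t -> coord j s = coord j t -> s = t.
Proof.
move=> ij Ei Ej.
have Di : coord i (s.1 - t.1, s.2 - t.2) = 0 by rewrite coordB Ei subrr.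
have Dj : coord j (s.1 - t.1, s.2 - t.2) = 0 by rewrite coordB Ej subrr.
have [] := coord_ker ij Di Dj.
by case: s t {Ei Ej Di Dj} => x y [x' y'] /= /subr0_eq-> /subr0_eq->.
Qed.

(** An injective map from a finite set to itself is onto. *)
Lemma coord_surj i j x y : i != j -> exists s, coord i s = x /\ coord j s = y.
Proof.
move=> ij; have inj : injective (fun s => (coord i s, coord j s)).
  by move=> s t [Ei Ej]; apply: (coord_inj ij Ei Ej).
exists (invF inj (x, y)).
by have [-> ->] := f_invF inj (x, y).
Qed.

(** * Vertices, words and mates *)

Definition place (v : V) : bool * bool :=
  match v with inl a => (false, a.1) | inr b => (true, b.1) end.

Definition value (v : V) : F := match v with inl a => a.2 | inr b => b.2 end.

Definition vert (i : bool * bool) (x : F) : V :=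
  if i.1 then inr (i.2, x) else inl (i.2, x).

Definition opp (i : bool * bool) := (i.1, ~~ i.2).

Definition on (v : V) (s : word) := coord (place v) s == value v.

Definition mate (v : V) (s : word) : V :=
  vert (opp (place v)) (coord (opp (place v)) (flip s)).

Lemma vertK v : vert (place v) (value v) = v.
Proof. by case: v => -[]. Qed.

Lemma place_vert i x : place (vert i x) = i.
Proof. by case: i => [[] []]. Qed.

Lemma value_vert i x : value (vert i x) = x.
Proof. by case: i => [[] []]. Qed.

Lemma oppK : involutive opp.
Proof. by case=> p i; rewrite /opp negbK. Qed.

Lemma opp_neq i : opp i != i.
Proof. by case: i => [[] []]. Qed.

Lemma place_mate v s : place (mate v s) = opp (place v).
Proof. exact: place_vert. Qed.

Lemma on_mate v s : on (mate v s) (flip s).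
Proof. by rewrite /on place_mate value_vert. Qed.

Lemma mateK v s : on v s -> mate (mate v s) (flip s) = v.
Proof.
by rewrite /on {1}/mate place_mate oppK flipK => /eqP->; apply: vertK.
Qed.

Lemma mate_inj v s t : on v s -> on v t -> mate v s = mate v t -> s = t.
Proof.
move=> /eqP vs /eqP vt /(congr1 value); rewrite !value_vert => /coord_flip.
by apply: (coord_inj (i := place v)); rewrite ?vs // eq_sym opp_neq.
Qed.

Lemma on_inj v w s t : v != w -> on v s -> on w s -> on v t -> on w t -> s = t.
Proof.
move=> vw /eqP vs /eqP ws /eqP vt /eqP wt.
case: (eqVneq (place v) (place w)) => [E|ne]; last first.
  by apply: coord_inj ne _ _; rewrite ?vs ?ws.
by case/eqP: vw; rewrite -(vertK v) -(vertK w) -vs -ws E.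
Qed.

Lemma on_pair v w : place v != place w -> exists s, on v s && on w s.
Proof.
move=> vw; have [s [vs ws]] := coord_surj (value v) (value w) vw.
by exists s; rewrite /on vs ws !eqxx.
Qed.

Lemma mate_pair v w : place w = opp (place v) -> exists2 s, on v s & w = mate v s.
Proof.
move=> Ew; have vw : place v != place w by rewrite Ew eq_sym opp_neq.
(* Passing to [flip s] adds [coord (place w) (1, 0)] to the coordinate, so this amount is subtracted
   in advance. *)
have [s [vs ws]] := coord_surj (value v) (value w - coord (place w) (1, 0)) vw.
exists s; first by rewrite /on vs.
rewrite -[LHS]vertK /mate -Ew; congr vert.
move/eqP: ws; rewrite eq_sym subr_eq => /eqP->.
by case: (place w) => [[] []] /=; rewrite ?mulr0 ?addr0 // addrAC.
Qed.

(* An arbitrary choice of one word in each orbit of [flip]. *)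
Definition forward (s : word) := (enum_rank s < enum_rank (flip s))%N.

Lemma forward_flip s : forward (flip s) = ~~ forward s.
Proof.
rewrite /forward flipK -leqNgt [RHS]leq_eqVlt; case: eqP => // E0.
have E := enum_rank_inj (ord_inj E0).
by case/eqP: (flip_neq s).
Qed.

(** * Cells from the code *)

Lemma common_word (z : A * A) : exists s, on (inl z.1) s && on (inr z.2) s.
Proof. exact: on_pair. Qed.

Definition the_word z := xchoose (common_word z).

Lemma the_wordP z s : on (inl z.1) s -> on (inr z.2) s -> the_word z = s.
Proof.
have /andP[h1 h2] := xchooseP (common_word z).
by move=> h3 h4; apply: (on_inj _ h1 h2 h3 h4).
Qed.

Definition unside (v : V) : A := match v with inl a | inr a => a end.

(** The other position of the cell: both coordinates move along the one word through [z]. *)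
Definition partner (z : A * A) : A * A :=
  (unside (mate (inl z.1) (the_word z)), unside (mate (inr z.2) (the_word z))).

Lemma mate_inl a s : exists2 a' : A, mate (inl a) s = inl a' & a'.1 = ~~ a.1.
Proof. by eexists. Qed.

Lemma mate_inr a s : exists2 a' : A, mate (inr a) s = inr a' & a'.1 = ~~ a.1.
Proof. by eexists. Qed.

Lemma partnerE z s : on (inl z.1) s -> on (inr z.2) s ->
  mate (inl z.1) s = inl (partner z).1 /\ mate (inr z.2) s = inr (partner z).2.
Proof. by move=> h1 h2; rewrite /partner (the_wordP h1 h2). Qed.

Lemma partner_spec z : exists s,
  [/\ on (inl z.1) s, on (inr z.2) s,
      mate (inl z.1) s = inl (partner z).1 & mate (inr z.2) s = inr (partner z).2].
Proof.
have [s /andP[h1 h2]] := common_word z; have [m1 m2] := partnerE h1 h2.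
by exists s.
Qed.

(** The word through the partner is [flip s], and [mateK] leads back along it. *)
Lemma partnerK : involutive partner.
Proof.
move=> z; have [s [h1 h2 m1 m2]] := partner_spec z.
have h1' := on_mate (inl z.1) s; have h2' := on_mate (inr z.2) s.
rewrite m1 in h1'; rewrite m2 in h2'.
have [] := partnerE h1' h2'; rewrite -m1 -m2 !mateK // => e1 e2.
have E1 : z.1 = (partner (partner z)).1 := congr1 unside e1.
have E2 : z.2 = (partner (partner z)).2 := congr1 unside e2.
by rewrite [LHS]surjective_pairing -E1 -E2 -surjective_pairing.
Qed.

Lemma partner_side z : (partner z).1.1 = ~~ z.1.1 /\ (partner z).2.1 = ~~ z.2.1.
Proof. by []. Qed.

Lemma partner_neq z : partner z != z.
Proof.
apply/eqP => E; have [+ _] := partner_side z; rewrite E.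
by case: (z.1.1).
Qed.

Definition code_cells : {set {set A * A}} := [set [set z; partner z] | z in setT].

Lemma code_cellP (C : {set A * A}) z :
  C \in code_cells -> z \in C -> C = [set z; partner z].
Proof.
case/imsetP => x _ ->; rewrite !inE => /orP[] /eqP-> //.
by rewrite partnerK setUC.
Qed.

Lemma code_partition : partition code_cells [set: A * A].
Proof.
apply/and3P; split.
- rewrite eqEsubset subsetT; apply/subsetP => z _; apply/bigcupP.
  by exists [set z; partner z]; [apply: imset_f | apply: set21].
- apply/trivIsetP => C D CC DD; apply: contraR => /pred0Pn[z /andP[/= zC zD]].
  by rewrite (code_cellP CC zC) (code_cellP DD zD).
- by apply/imsetP => -[z _ /setP/(_ z)]; rewrite !inE eqxx.
Qed.

(** In both coordinates [partner] moves to the other copy of [F]. *)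
Lemma code_injective (C : {set A * A}) (x y : A * A) :
  C \in code_cells -> x \in C -> y \in C -> x <> y -> x.1 <> y.1 /\ x.2 <> y.2.
Proof.
move=> CC xC; rewrite (code_cellP CC xC) !inE => /orP[] /eqP-> // _.
have [s1 s2] := partner_side x.
split=> E; [move: s1|move: s2]; rewrite -E; first by case: (x.1.1).
by case: (x.2.1).
Qed.

Definition code_ps : product_structure :=
  ProductStructure code_partition code_injective.

Lemma code_even : even_ps code_ps.
Proof. by move=> C /imsetP[z _ ->]; rewrite cards2 eq_sym partner_neq. Qed.

Lemma code_cellE (x y : A * A) : ([set x; y] \in cells code_ps) = (y == partner x).
Proof.
apply/idP/eqP => [xy|->]; last by apply: imset_f.
have := code_cellP xy (set21 x y) => /setP/(_ (partner x)).
rewrite !inE eqxx orbT (negbTE (partner_neq x)) => /eqP->//.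
Qed.

Lemma code_two_cell (x y : A * A) : @two_cell code_ps x y = (y == partner x).
Proof.
rewrite /two_cell code_cellE andb_idl // => /eqP->.
by rewrite eq_sym partner_neq.
Qed.

Lemma two_cellP (x y : A * A) : reflect
  (exists s, [/\ on (inl x.1) s, on (inr x.2) s, mate (inl x.1) s = inl y.1 &
     mate (inr x.2) s = inr y.2]) (@two_cell code_ps x y).
Proof.
rewrite code_two_cell; apply: (iffP eqP) => [->|[s [h1 h2 m1 m2]]].
  exact: partner_spec.
have [] := partnerE h1 h2; rewrite m1 m2 => e1 e2.
have E1 : y.1 = (partner x).1 := congr1 unside e1.
have E2 : y.2 = (partner x).2 := congr1 unside e2.
by rewrite [LHS]surjective_pairing E1 E2 -surjective_pairing.
Qed.

(** Vertices in different copies of [F] are mates along some word by [mate_pair], and any [b] on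
    that word completes a cell. *)
Lemma code_adjA (a a' : A) : @LA_adj code_ps a a' = (a.1 != a'.1).
Proof.
apply/andP/idP => [[_ /existsP[b /existsP[b' ]]]|aa'].
  rewrite code_cellE => /eqP E; have [s1 _] := partner_side (a, b).
  by rewrite -E /= in s1; rewrite s1; case: (a.1).
split; first by apply: contraNneq aa' => ->.
have Ea' : place (inl a') = opp (place (inl a)).
  by rewrite /opp /=; congr (_, _); case: (a.1) (a'.1) aa' => [] [].
have [s as_ E] := mate_pair Ea'.
have [b /eqP Eb] : exists b : A, coord (true, b.1) s == b.2.
  by exists (false, coord (true, false) s).
have [b' mb _] := mate_inr b s.
apply/existsP; exists b; apply/existsP; exists b'.
suff /andP[] : @two_cell code_ps (a, b) (a', b') by [].
by apply/two_cellP; exists s; split=> //; apply/eqP.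
Qed.

Lemma code_adjB (b b' : A) : @LB_adj code_ps b b' = (b.1 != b'.1).
Proof.
apply/andP/idP => [[_ /existsP[a /existsP[a' ]]]|bb'].
  rewrite code_cellE => /eqP E; have [_ s2] := partner_side (a, b).
  by rewrite -E /= in s2; rewrite s2; case: (b.1).
split; first by apply: contraNneq bb' => ->.
have Eb' : place (inr b') = opp (place (inr b)).
  by rewrite /opp /=; congr (_, _); case: (b.1) (b'.1) bb' => [] [].
have [s bs E] := mate_pair Eb'.
have [a /eqP Ea] : exists a : A, coord (false, a.1) s == a.2.
  by exists (false, coord (false, false) s).
have [a' ma _] := mate_inl a s.
apply/existsP; exists a; apply/existsP; exists a'.
suff /andP[] : @two_cell code_ps (a, b) (a', b') by [].
by apply/two_cellP; exists s; split=> //; apply/eqP.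
Qed.

Lemma code_adjE (v w : V) :
  @adj (LAB code_ps) v w = (place w == opp (place v)).
Proof.
case: v w => [a|b] [a'|b'] //=.
- by rewrite code_adjA /opp /= xpair_eqE eqxx /=; case: (a.1); case: (a'.1).
- by rewrite code_adjB /opp /= xpair_eqE eqxx /=; case: (b.1); case: (b'.1).
Qed.

(** * Orientation and colors *)

Definition code_orient : rel (LAB code_ps) :=
  fun v w => [exists s, [&& on v s, w == mate v s & forward s]].

Lemma orient_mate v s : on v s -> code_orient v (mate v s) = forward s.
Proof.
move=> vs; apply/existsP/idP => [[t /and3P[vt /eqP E ft]]|fs].
  by rewrite (mate_inj vs vt E).
by exists s; rewrite vs eqxx.
Qed.

Lemma orient_mate_rev v s : on v s -> code_orient (mate v s) v = ~~ forward s.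
Proof.
by move=> vs; rewrite -{2}(mateK vs) orient_mate ?on_mate ?forward_flip.
Qed.

(** The two edges of a cell leave [a] and [b] along the same word [s], and [forward s] directs
    both. *)
Lemma code_coherent : coherent code_orient.
Proof.
split; first split.
- move=> v w /existsP[s /and3P[_ /eqP-> _]].
  by rewrite code_adjE place_mate.
- move=> v w; rewrite code_adjE => /eqP/mate_pair[s vs ->].
  by rewrite orient_mate // orient_mate_rev // negbK.
move=> a a' b b' /two_cellP[s /= [as_ bs ma mb]].
rewrite -ma -mb !orient_mate // !orient_mate_rev //.
by case: (forward s); [left | right].
Qed.

(* As every edge is carried by exactly two words, [s] and [flip s], carrying [s]
   is invariant under [color_step]: colors are the orbits of [flip]. *)
Definition carries (e : {set V}) s := [exists v, on v s && (e == [set v; mate v s])].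

Lemma carries_mate v s : on v s -> carries [set v; mate v s] s.
Proof. by move=> vs; apply/existsP; exists v; rewrite vs eqxx. Qed.

Lemma set2_eq (T : finType) (x y x' y' : T) : [set x; y] = [set x'; y'] ->
  (x = x' /\ y = y') \/ (x = y' /\ y = x').
Proof.
move=> E; have := set21 x y; have := set22 x y.
have := set21 x' y'; have := set22 x' y'.
rewrite -{1 2}E {3 4}E !inE.
by move=> /orP[]/eqP p1 /orP[]/eqP p2 /orP[]/eqP p3 /orP[]/eqP p4;
  intuition congruence.
Qed.

(** Ends matched in order give [s] by [mate_inj]; matched in reverse, the edge is read from its
    other end, where the word is [flip s]. *)
Lemma carries_mate_inv v s t : on v s -> carries [set v; mate v s] t ->
  t = s \/ t = flip s.
Proof.
move=> vs /existsP[w /andP[wt /eqP/set2_eq[[E1 E2]|[E1 E2]]]].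
  by left; rewrite -E1 in E2 wt; apply: (mate_inj wt vs).
right; apply: (@mate_inj w) => //; first by rewrite -E2 on_mate.
by rewrite -E1 -E2 mateK.
Qed.

Lemma carries_flip e s : carries e s -> carries e (flip s).
Proof.
case/existsP=> v /andP[vs /eqP->]; apply/existsP; exists (mate v s).
by rewrite on_mate mateK // setUC /=.
Qed.

(** Both edges of a cell are carried by its word [t] and by no words but [t] and [flip t]. *)
Lemma carries_step e f s : @color_step code_ps e f || @color_step code_ps f e ->
  carries e s -> carries f s.
Proof.
have key g h : @color_step code_ps g h ->
    exists t, [/\ carries g t, carries h t & forall s, carries g s || carries h s ->
      s = t \/ s = flip t].
  case/existsP=> x /existsP[y /and3P[/two_cellP[t [xt1 xt2 m1 m2]] /eqP-> /eqP->]].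
  exists t; rewrite -m1 -m2; split; try exact: carries_mate.
  by move=> u /orP[] /carries_mate_inv; apply.
case/orP => /key[t [gt ht tP]] es.
  by case: (tP s); rewrite ?es // => ->; rewrite ?carries_flip.
by case: (tP s); rewrite ?es ?orbT // => ->; rewrite ?carries_flip.
Qed.

Lemma carries_same_color e f s :
  @same_color code_ps e f -> carries e s -> carries f s.
Proof.
case/connectP=> p; elim: p e => [e _ ->//|g p IH e /= /andP[eg gp] Ef es].
by apply: IH gp Ef _; apply: carries_step es.
Qed.

Lemma word_on i s : on (vert i (coord i s)) s.
Proof. by rewrite /on place_vert value_vert. Qed.

Lemma color_step_carries a b s : on (inl a) s -> on (inr b) s ->
  @color_step code_ps [set inl a; mate (inl a) s] [set inr b; mate (inr b) s].
Proof.
move=> as_ bs; have [a' ma _] := mate_inl a s; have [b' mb _] := mate_inr b s.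
apply/existsP; exists (a, b); apply/existsP; exists (a', b').
rewrite ma mb !eqxx !andbT.
by apply/two_cellP; exists s.
Qed.

(** Edges along [s] on opposite sides come from one cell; two on the same side are joined through
    one on the other side. *)
Lemma same_color_carries v w s : on v s -> on w s ->
  @same_color code_ps [set v; mate v s] [set w; mate w s].
Proof.
have AB a b : on (inl a) s -> on (inr b) s ->
    @same_color code_ps [set inl a; mate (inl a) s] [set inr b; mate (inr b) s].
  by move=> as_ bs; apply: connect1; rewrite color_step_carries.
have BA a b : on (inl a) s -> on (inr b) s ->
    @same_color code_ps [set inr b; mate (inr b) s] [set inl a; mate (inl a) s].
  by move=> as_ bs; apply: connect1; rewrite color_step_carries ?orbT.
have a0 := word_on (false, false) s; have b0 := word_on (true, false) s.
case: v w => [a|b] [a'|b'] vs ws; [|exact: AB|exact: BA|].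
  exact: connect_trans (AB _ _ vs b0) (BA _ _ ws b0).
exact: connect_trans (BA _ _ a0 vs) (AB _ _ a0 ws).
Qed.

Lemma mate_edge v s : [set v; mate v s] \in edges (LAB code_ps).
Proof.
by apply: (@mem_edges (LAB code_ps)); rewrite code_adjE place_mate.
Qed.

Definition base (s : word) : V := vert (false, false) (coord (false, false) s).

Definition color_of (s : word) : color code_ps :=
  xchoose (edge_color (mate_edge (base s) s)).

Lemma color_ofP v s : on v s -> [set v; mate v s] \in val (color_of s).
Proof.
move=> vs; have bs := xchooseP (edge_color (mate_edge (base s) s)).
by rewrite (mem_color _ bs) mate_edge; apply: same_color_carries (word_on _ _) vs.
Qed.

Lemma color_of_eq (c : color code_ps) v s :
  on v s -> [set v; mate v s] \in val c -> c = color_of s.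
Proof. by move=> vs vc; apply: color_inj vc (color_ofP vs). Qed.

Lemma color_of_flip s : color_of (flip s) = color_of s.
Proof.
have vs : on (base s) s := word_on _ _.
apply: (color_of_eq vs); have := color_ofP (on_mate (base s) s).
by rewrite mateK // setUC.
Qed.

Definition signed (s : word) : color code_ps * bool := (color_of s, forward s).

Lemma signed_flip s : signed (flip s) = (color_of s, ~~ forward s).
Proof. by rewrite /signed color_of_flip forward_flip. Qed.

(** Words of the same color are equal or exchanged by [flip], and [flip] reverses the sign. *)
Lemma signed_inj : injective signed.
Proof.
move=> s t [cst fst_].
have vs : on (base s) s := word_on _ _; have vt : on (base t) t := word_on _ _.
have est := color_ofP vs; rewrite cst (mem_color _ (color_ofP vt)) in est.
have /andP[_ /carries_same_color/(_ (carries_mate vt))] := est.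
case/(carries_mate_inv vs) => [//|E].
by move: fst_; rewrite E forward_flip; case: (forward s).
Qed.

Lemma out_edgeP (c : color code_ps) (v w : V) : out_edge code_orient c v w ->
  exists s, [/\ on v s, w = mate v s & signed s = (c, true)].
Proof.
case/andP=> /existsP[s /and3P[vs /eqP-> fs]] vc.
by exists s; rewrite /signed fs -(color_of_eq vs vc).
Qed.

Lemma in_edgeP (c : color code_ps) (v w : V) : out_edge code_orient c w v ->
  exists s, [/\ on v s, w = mate v s & signed s = (c, false)].
Proof.
case/out_edgeP=> s [ws -> [cs fs]]; exists (flip s).
by rewrite on_mate mateK // signed_flip cs fs.
Qed.

Lemma code_no_fold : no_fold code_orient.
Proof.
move=> c v w w'; split.
  by move=> /out_edgeP[s [_ -> ss]] /out_edgeP[t [_ -> st]]; rewrite -st in ss;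
    rewrite (signed_inj ss).
by move=> /in_edgeP[s [_ -> ss]] /in_edgeP[t [_ -> st]]; rewrite -st in ss;
  rewrite (signed_inj ss).
Qed.

(** Through [signed], incidence in [L1] becomes incidence of vertices with words, so the girth can
    be computed in the code. *)
Lemma signed_incP (v : V) x :
  reflect (exists2 s, on v s & x = signed s) (signed_inc code_orient v x).
Proof.
apply: (iffP idP) => [|[s vs ->]].
  case: x => c [] /existsP[w].
    by case/out_edgeP=> s [vs _ ss]; exists s.
  by case/in_edgeP=> s [vs _ ss]; exists s.
rewrite /signed_inc /signed /=; case fs: (forward s); apply/existsP;
  exists (mate v s); rewrite /out_edge.
  by rewrite orient_mate // fs color_ofP.
by rewrite orient_mate_rev // fs setUC color_ofP.
Qed.

Lemma signed_inc_signed v s : signed_inc code_orient v (signed s) = on v s.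
Proof.
apply/signed_incP/idP => [[t vt /signed_inj->]//|vs]; by exists s.
Qed.

(** * Girths of the code structure *)

Lemma L1_no_square : ~~ has_cycle (L1 code_orient) 4.
Proof.
apply: bip_no_square => v w x y vw /signed_incP[s vs Es] /signed_incP[s1 ws Es1].
move=> /signed_incP[t vt Et] /signed_incP[t1 wt Et1].
have E1 : s1 = s by apply: signed_inj; rewrite -Es.
have E2 : t1 = t by apply: signed_inj; rewrite -Et.
rewrite E1 in ws; rewrite E2 in wt.
by rewrite Es Et (on_inj vw vs ws vt wt).
Qed.

Lemma L1_girth : girth (L1 code_orient) = Some 6.
Proof.
apply: girth_eq.
  (* The conditions [x = 0], [y = 0] and [x + y = 1] meet pairwise in the words (0, 0), (1, 0) and
     (0, 1). *)
  pose v1 : V := inl (false, 0); pose v2 : V := inl (true, 0).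
  pose v3 : V := inr (false, 1).
  apply: (@bip_hexagon _ _ _ v1 v2 v3
    (signed (0, 0)) (signed (1, 0)) (signed (0, 1))).
  - by split.
  - rewrite !(inj_eq signed_inj) !xpair_eqE.
    by rewrite (eq_sym 0) oner_eq0 ?andbF.
  - by rewrite !signed_inc_signed /on /= ?addr0 ?add0r !eqxx.
  - by rewrite !signed_inc_signed /on /= ?addr0 ?add0r !eqxx.
move=> k k6; apply/negP => ck; have /andP[k_gt2 _] := has_cycle_bounds ck.
have k_even : ~~ odd k.
  apply: (@bipartite_even (L1 code_orient)
    (fun x => if x is inl _ then true else false)) ck.
  by case=> [v|x] [w|y].
have k4 : k = 4 by move: k k6 k_gt2 k_even {ck} => [|[|[|[|[|[|]]]]]].
by move: ck; rewrite k4 (negbTE L1_no_square).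
Qed.

Lemma LAB_girth : girth (LAB code_ps) = Some 4.
Proof.
apply: girth_eq.
  pose c : seq (LAB code_ps) := [:: inl (false, 0); inl (true, 0);
    inl (false, 1); inl (true, 1)].
  apply: (@has_cycle_seq _ c) => //.
  rewrite /ucycle /= !code_adjA !inE /= !eqE /= !eqE /=.
  by rewrite ?(eq_sym 0) ?oner_eq0.
(* The copy of [F] holding a vertex gives a proper 2-coloring, which excludes length 3. *)
move=> k k4; apply/negP => ck; have /andP[k_gt2 _] := has_cycle_bounds ck.
have k_even : ~~ odd k.
  apply: (@bipartite_even (LAB code_ps) (fun v => (place v).2)) ck => v w.
  by rewrite code_adjE => /eqP->; rewrite /opp /=; case: (_.2).
by move: k k4 k_gt2 k_even {ck} => [|[|[|[|]]]].
Qed.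

Lemma sided_iso (G : sgraph) (h : A -> G) : bijective h ->
  (forall a a', adj (h a) (h a') = (a.1 != a'.1)) ->
  sg_iso G (complete_bipartite #|F| #|F|).
Proof.
move=> [g hK gK] h_adj.
pose f (a : A) : complete_bipartite #|F| #|F| :=
  if a.1 then inr (enum_rank a.2) else inl (enum_rank a.2).
pose f' (x : complete_bipartite #|F| #|F|) : A :=
  match x with inl i => (false, enum_val i) | inr i => (true, enum_val i) end.
have fK : cancel f f' by case=> -[] x; rewrite /f /f' /= enum_rankK.
have f'K : cancel f' f by case=> i; rewrite /f /f' /= enum_valK.
exists (f \o g); first by exists (h \o f') => x /=; rewrite ?fK ?hK ?gK ?f'K.
move=> x y; rewrite -[x in RHS]gK -[y in RHS]gK h_adj /f /=.
by case: (g x).1; case: (g y).1.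
Qed.

Lemma code_structure : exists (Pi : product_structure) (O : rel (LAB Pi)),
  even_ps Pi /\ of_type Pi (2 * #|F|) (2 * #|F|) /\ oriented_no_fold O /\
  girth (L1 O) = Some 6 /\
  sg_iso (LA Pi) (complete_bipartite #|F| #|F|) /\
  sg_iso (LB Pi) (complete_bipartite #|F| #|F|) /\
  half_girth (L1 O) = Some 3 /\
  girth (LAB Pi) = Some 4.
Proof.
exists code_ps, code_orient; split; first exact: code_even.
split; first by rewrite /of_type /= card_prod card_bool.
split; first by split; [exact: code_coherent | exact: code_no_fold].
split; first exact: L1_girth.
have idb : bijective (id : A -> A) by exists id.
split; first exact: (@sided_iso (LA code_ps) id idb code_adjA).
split; first exact: (@sided_iso (LB code_ps) id idb code_adjB).
by rewrite /half_girth L1_girth; split; last exact: LAB_girth.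
Qed.

End Construction.

(** * Powers of two and the threshold *)

Lemma char2_code_structure q : (exists k : nat, q = 2 ^ k) -> 4 <= q ->
  exists (Pi : product_structure) (O : rel (LAB Pi)),
    even_ps Pi /\ of_type Pi (2 * q) (2 * q) /\ oriented_no_fold O /\
    girth (L1 O) = Some 6 /\
    sg_iso (LA Pi) (complete_bipartite q q) /\
    sg_iso (LB Pi) (complete_bipartite q q) /\
    half_girth (L1 O) = Some 3 /\
    girth (LAB Pi) = Some 4.
Proof.
case=> k -> q4; have k0 : 0 < k by case: k q4.
have [F charF cardF] := pPrimePowerField (isT : prime 2) k0.
(* A field with at least 4 elements has one besides 0 and 1. *)
have [lam lamP] : exists lam : F, lam \notin [:: 0; 1]%R.
  apply/existsP; move: q4; rewrite -cardF; apply: contraTT => /existsPn all01.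
  rewrite -ltnNge; apply: leq_ltn_trans (_ : size [:: 0%R; 1%R : F] < 4) => //.
  apply: leq_trans (card_size _); apply: subset_leq_card; apply/subsetP => x _.
  by have := all01 x; rewrite negbK.
rewrite -cardF; move: lamP; rewrite !inE negb_or => /andP[lam0 lam1].
by apply: (@code_structure F lam) => // x; apply: GRing.addrr_pchar2.
Qed.

Lemma realized_4_3 : realized 4 3.
Proof.
have [Pi [O [ev [[cA cB] [nf [_ [_ [_ [h3 g4]]]]]]]]] :=
  @char2_code_structure 4 (ex_intro _ 2 erefl) isT.
by exists Pi, O; split; rewrite ?cA ?cB //; left.
Qed.

Lemma not_obstructed p : p <= 4 -> ~ obstructed p.
Proof.
move=> p4; apply.
have [Pi [O [ev [[cA cB] [nf [g6 [_ [_ [_ g4]]]]]]]]] :=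
  @char2_code_structure 4 (ex_intro _ 2 erefl) isT.
exists Pi, O; split=> //; rewrite ?cA ?cB //; first by left.
  by rewrite /girth_ge g4.
by rewrite /girth_ge g6.
Qed.

Theorem theoremC :
  (forall q : nat, (exists k : nat, q = 2 ^ k) -> 4 <= q ->
    exists (Pi : product_structure) (O : rel (LAB Pi)),
      even_ps Pi /\ of_type Pi (2 * q) (2 * q) /\ oriented_no_fold O /\
      girth (L1 O) = Some 6 /\
      sg_iso (LA Pi) (complete_bipartite q q) /\
      sg_iso (LB Pi) (complete_bipartite q q) /\
      half_girth (L1 O) = Some 3 /\
      girth (LAB Pi) = Some 4)
  /\ realized 4 3
  /\ exists p : nat, is_pstar p /\ (p = 5 \/ p = 6).
Proof.
split; first exact: char2_code_structure.
split; first exact: realized_4_3.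
have ge5 p : obstructed p -> 5 <= p.
  by move=> ob; rewrite ltnNge; apply/negP=> /not_obstructed; apply.
(* The construction excludes every value up to 4 and [obstructed6] bounds the threshold by 6;
   excluded middle on 5 chooses between the two remaining values. *)
case: (classic (obstructed 5)) => [ob5|nob5].
  by exists 5; split; [split=> // p _; apply: ge5 | left].
exists 6; split; last by right.
split=> //; first exact: obstructed6.
move=> p _ ob; have := ge5 p ob; rewrite leq_eqVlt => /orP[/eqP E|//].
by case: nob5; rewrite E.
Qed.
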